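(* Let $\mathscr{F}$ be a sheaf of functions on $\Omega$ satisfying property $(\mathscr{F}1)$ such that for every open $Y\subseteq\Omega$ the topology of $\mathscr{F}(Y)$ is the compact-open topology and $\mathscr{F}(Y)$ is a Fréchet–Montel space. Let $X\subseteq\Omega$ be open, let $\psi:X\to X$ be continuous, and assume that the composition operator $C_\psi:\mathscr{F}(X)\to\mathscr{F}(X)$, $f\mapsto f\circ\psi$, is well-defined. Assume that additionally the following conditions hold. (a) There is an open, relatively compact exhaustion $(X_n)_{n\in\mathbb{N}}$ of $X$ such that for each $n\in\mathbb{N}$, every $x\in X\setminus\overline{X}_n$ and every open $W\subseteq X\setminus\overline{X}_n$ containing $x$ there is an open $U\subseteq W$ with $x\in U$ for which the restriction $r_X^{X_n\cup U}:\mathscr{F}(X)\to\mathscr{F}(X_n\cup U)$ has dense range. (b) $\ker\delta_x\neq\mathscr{F}(X)$ for each $x\in X$. Then the following are equivalent. (i) $C_\psi$ is power bounded on $\mathscr{F}(X)$. (ii) $C_\psi$ is uniformly mean ergodic on $\mathscr{F}(X)$. (iii) $C_\psi$ is mean ergodic on $\mathscr{F}(X)$. (iv) $C_\psi$ is $m$-topologizable on $\mathscr{F}(X)$. (v) $C_\psi$ is topologizable on $\mathscr{F}(X)$. (vi) $\psi$ has stable orbits.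
   Context: $\mathbb{K}\in\{\mathbb{R},\mathbb{C}\}$; $\Omega$ is a locally compact, $\sigma$-compact, non-compact Hausdorff space. A sheaf of functions $\mathscr{F}$ on $\Omega$ assigns to every open $X\subseteq\Omega$ a vector space $\mathscr{F}(X)$ of $\mathbb{K}$-valued functions on $X$ such that for open $Y\subseteq X$ the restriction $r_X^Y:\mathscr{F}(X)\to\mathscr{F}(Y)$, $f\mapsto f_{|Y}$, is well-defined, functions in $\mathscr{F}(X)$ agreeing on all members of an open cover of $X$ are equal, and for every open cover $(X_\iota)_{\iota\in I}$ of $X$ and $f_\iota\in\mathscr{F}(X_\iota)$ with $f_\iota=f_\kappa$ on $X_\iota\cap X_\kappa$ for all $\iota,\kappa\in I$ there is $f\in\mathscr{F}(X)$ with $f_{|X_\iota}=f_\iota$ for all $\iota$. An open, relatively compact exhaustion of $X$ is a sequence $(X_n)$ of open subsets of $X$ with compact closures $\overline{X}_n\subseteq X_{n+1}$ and $\bigcup_n X_n=X$. $\mathscr{F}$ satisfies $(\mathscr{F}1)$ if for every open $X\subseteq\Omega$: $\mathscr{F}(X)$ is a webbed and ultrabornological Hausdorff locally convex space; $\mathscr{F}(X)\subseteq C(X)$ (continuous $\mathbb{K}$-valued functions); for each $x\in X$ the point evaluation $\delta_x:f\mapsto f(x)$ is a continuous linear functional on $\mathscr{F}(X)$; and for every open, relatively compact exhaustion $(X_n)$ of $X$ the canonical map $f\mapsto(f_{|X_n})_n$ is a topological isomorphism of $\mathscr{F}(X)$ onto the projective limit $\{(f_n)_n\in\prod_n\mathscr{F}(X_n):\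 f_n=f_{n+1|X_n}\ \forall n\}$ (with the topology induced by the product). The compact-open topology is defined by the seminorms $\|f\|_K=\sup_{x\in K}|f(x)|$, $K\subseteq X$ compact. $\psi^m$ is the $m$-fold iterate of $\psi$. A continuous map $\psi:X\to X$ has stable orbits if for every compact $K\subseteq X$ there is a compact $L\subseteq X$ with $\psi^m(K)\subseteq L$ for all $m\in\mathbb{N}$. Let $T$ be a continuous linear operator on a locally convex space $E$; $p,q$ denote continuous seminorms on $E$. $T$ is topologizable if for every $p$ there is $q$ such that for every $m\in\mathbb{N}$ there is $\gamma_m>0$ with $p(T^m x)\le\gamma_m q(x)$ for all $x\in E$; $m$-topologizable if for every $p$ there are $q$ and $\gamma>0$ such that $p(T^m x)\le\gamma^m q(x)$ for all $m\in\mathbb{N}$, $x\in E$; power bounded if for every $p$ there is $q$ such that $p(T^m x)\le q(x)$ for all $m\in\mathbb{N}$, $x\in E$. With $T_{[n]}=\frac1n\sum_{m=1}^nT^m$, $T$ is mean ergodic if $(T_{[n]}x)_n$ converges in $E$ for every $x\in E$, and uniformly mean ergodic if $(T_{[n]})_n$ converges uniformly on bounded subsets of $E$. *)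

(* Defs.v *)
From HB Require Import structures.
From mathcomp Require Import all_boot all_order all_algebra.
From mathcomp Require Import all_classical all_reals all_analysis.
From mathcomp Require Import complex.

Set Implicit Arguments.
Unset Strict Implicit.
Unset Printing Implicit Defensive.

Import Order.TTheory GRing.Theory Num.Theory.
Import numFieldNormedType.Exports.

Local Open Scope classical_set_scope.
Local Open Scope ring_scope.

Inductive real_or_complex (R : realType) : numFieldType -> Prop :=
| scalars_real : real_or_complex R R
| scalars_complex : real_or_complex R R[i].

Definition sigma_compact (T : topologicalType) :=
  exists C : nat -> set T,
    (forall n, compact (C n)) /\ \bigcup_n C n = [set: T].

(** * Locally convex spaces

   Moduli, seminorms and positive constants take values in [K], as norms do in
   the library; [0 <= c] in [R[i]] forces [c] to be real.  The uniformity
   carried by a [tvsType] is only required to induce the topology, not to be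
   translation invariant, so Cauchy filters and uniform convergence are
   expressed through neighbourhoods of 0. *)

Section LocallyConvex.
Variables (K : numFieldType) (E : tvsType K).
Implicit Types (A B U : set E) (p q : E -> K).

Definition continuous_seminorm p :=
  [/\ forall x, 0 <= p x,
      forall (a : K) x, p (a *: x) = `|a| * p x,
      forall x y, p (x + y) <= p x + p y
    & continuous p].

Definition absolutely_convex A :=
  forall (a b : K) x y, `|a| + `|b| <= 1 -> A x -> A y -> A (a *: x + b *: y).

Definition absorbs U A :=
  exists2 r : K, 0 < r & forall a : K, r <= `|a| -> A `<=` *:%R a @` U.

Definition bounded_subset B := forall U, nbhs 0 U -> absorbs U B.

Definition converges (u : nat -> E) := exists l : E, u @ \oo --> l.

Definition linear_cauchy (F : set_system E) :=
  forall U, nbhs 0 U ->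
    exists2 A, F A & forall x y, A x -> A y -> U (x - y).

Definition linear_complete :=
  forall F : set_system E, ProperFilter F -> linear_cauchy F ->
    exists x : E, F --> x.

Definition metrizable (R : realType) :=
  exists d : E -> E -> R,
    [/\ forall x y, (d x y = 0) <-> (x = y),
        forall x y, d x y = d y x,
        forall x y z, d x z <= d x y + d y z
      & forall x A, nbhs x A <->
          exists2 e : R, 0 < e & [set y | d x y < e] `<=` A].

Definition frechet (R : realType) := metrizable R /\ linear_complete.

Definition barrel A :=
  [/\ closed A, absolutely_convex A & forall x, absorbs A [set x]].

Definition barrelled := forall A, barrel A -> nbhs 0 A.

Definition montel :=
  [/\ hausdorff_space E, barrelled
    & forall B, bounded_subset B -> compact (closure B)].

(* De Wilde webs; the set attached to (n_1, ..., n_k) is [C [:: n_1; ...; n_k]] *)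
Definition web (C : seq nat -> set E) :=
  [/\ C [::] = [set: E],
      forall s, absolutely_convex (C s),
      forall s, C s = \bigcup_n C (rcons s n)
    & forall alpha : nat -> nat, exists2 lambda : nat -> K,
        (forall k, 0 < lambda k)
        & forall x : nat -> E, (forall k, C (mkseq alpha k.+1) (x k)) ->
            converges (series (fun k => lambda k *: x k))].

Definition webbed := exists C, web C.

Definition disk_span B : set E := [set x | exists a : K, ( *:%R a @` B) x].

(* The linear span of [B], normed by the gauge p_B, is a Banach space.  Since
   p_B z < e implies z in e B, which implies p_B z <= e, Cauchy sequences and
   limits for p_B are spelled with the multiples e B. *)
Definition banach_disk B :=
  [/\ absolutely_convex B, bounded_subset B
    & forall x : nat -> E, (forall n, disk_span B (x n)) ->
        (forall e : K, 0 < e -> exists N, forall m n, (N <= m)%N -> (N <= n)%N ->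
           ( *:%R e @` B) (x m - x n)) ->
        exists2 l : E, disk_span B l
          & forall e : K, 0 < e -> exists N, forall n, (N <= n)%N ->
              ( *:%R e @` B) (x n - l)].

Definition ultrabornological :=
  forall A, absolutely_convex A ->
    (forall B, banach_disk B -> absorbs A B) -> nbhs 0 A.

Section Operator.
Variable T : E -> E.

Definition topologizable :=
  forall p, continuous_seminorm p ->
    exists2 q, continuous_seminorm q
      & forall m, (0 < m)%N -> exists2 gamma : K, 0 < gamma
        & forall x, p (iter m T x) <= gamma * q x.

Definition m_topologizable :=
  forall p, continuous_seminorm p ->
    exists2 q, continuous_seminorm q
      & exists2 gamma : K, 0 < gamma
        & forall m x, (0 < m)%N -> p (iter m T x) <= gamma ^+ m * q x.

Definition power_bounded :=
  forall p, continuous_seminorm p ->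
    exists2 q, continuous_seminorm q
      & forall m x, (0 < m)%N -> p (iter m T x) <= q x.

(* the value at [n = 0] is 0 and irrelevant to convergence *)
Definition cesaro_mean (n : nat) (x : E) : E :=
  n%:R^-1 *: \sum_(1 <= m < n.+1) iter m T x.

Definition mean_ergodic := forall x, converges (fun n => cesaro_mean n x).

Definition uniformly_mean_ergodic :=
  exists P : E -> E, forall B, bounded_subset B -> forall U, nbhs 0 U ->
    \forall n \near \oo, forall x, B x -> U (cesaro_mean n x - P x).

End Operator.
End LocallyConvex.

(** * Sheaves of functions *)

Section Agree.
Variables (T : Type) (V : Type) (X Y : set T).

(* [f] and [g] coincide on [X `&` Y]; for [Y `<=` X], [g] is [f] restricted
   to [Y]. *)
Definition agree (f : X -> V) (g : Y -> V) :=
  forall (x : X) (y : Y), set_val x = set_val y -> f x = g y.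

End Agree.

(* [sections X] stands for the space F(X), whose elements are identified with
   functions on [X] through the injection [ev].  All fields are total; only
   their values at open sets (and at inclusions, for [res]) are meaningful. *)
Record function_space_family (K : numFieldType) (Omega : topologicalType) := {
  sections :> set Omega -> tvsType K ;
  ev : forall X : set Omega, sections X -> X -> K ;
  res : forall X Y : set Omega, sections X -> sections Y
}.

Arguments ev {K Omega} _ {X} _ _.
Arguments res {K Omega} _ {X} Y _.

Section Sheaf.
Variables (K : numFieldType) (Omega : topologicalType).
Variable F : function_space_family K Omega.
Implicit Types X Y : set Omega.

Definition open_cover (I : Type) (U : I -> set Omega) X :=
  (forall i, open (U i)) /\ \bigcup_i U i = X.

Record sheaf_of_functions : Prop := {
  sections_inj : forall X, open X -> injective (@ev K Omega F X) ;
  sections_linear : forall X, open X ->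
    forall (a : K) (f g : F X) (x : X),
      ev F (a *: f + g) x = a * ev F f x + ev F g x ;
  sections_restrict : forall X Y, open X -> open Y -> Y `<=` X ->
    forall f : F X, agree (ev F f) (ev F (res F Y f)) ;
  sections_separated : forall X (I : Type) (U : I -> set Omega),
    open X -> open_cover U X ->
    forall f g : F X, (forall i, res F (U i) f = res F (U i) g) -> f = g ;
  sections_glue : forall X (I : Type) (U : I -> set Omega),
    open X -> open_cover U X ->
    forall f : (forall i, F (U i)),
      (forall i j, agree (ev F (f i)) (ev F (f j))) ->
      exists g : F X, forall i, res F (U i) g = f i
}.

Definition exhaustion (Xs : nat -> set Omega) X :=
  [/\ forall n, open (Xs n),
      forall n, compact (closure (Xs n)),
      forall n, closure (Xs n) `<=` Xs n.+1
    & \bigcup_n Xs n = X].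

Definition restriction_sequence (Xs : nat -> set Omega) X (f : F X) :
  prod_topology (fun n => F (Xs n)) := fun n => res F (Xs n) f.

Definition projective_limit (Xs : nat -> set Omega) :
    set (prod_topology (fun n => F (Xs n))) :=
  [set f | forall n, f n = res F (Xs n) (f n.+1)].
Arguments projective_limit : clear implicits.

Definition topological_embedding (T U : topologicalType) (j : T -> U) :=
  [/\ injective j, continuous j
    & forall A, open A -> exists2 B, open B & j @` A = B `&` range j].

Definition eval_at X (x : X) (f : F X) : K := ev F f x.

Record property_F1 : Prop := {
  F1_hausdorff : forall X, open X -> hausdorff_space (F X) ;
  F1_webbed : forall X, open X -> webbed (F X) ;
  F1_ultrabornological : forall X, open X -> ultrabornological (F X) ;
  F1_continuous : forall X, open X -> forall f : F X, continuous (ev F f) ;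
  F1_eval : forall X, open X -> forall x : X, continuous (eval_at x) ;
  F1_limit : forall X, open X -> forall Xs, exhaustion Xs X ->
    topological_embedding (@restriction_sequence Xs X) /\
    range (@restriction_sequence Xs X) = projective_limit Xs
}.

(* [seminorm_ball C e] is the set of f with sup_C |f| <= e. *)
Definition seminorm_ball X (C : set X) (e : K) : set (F X) :=
  [set f | forall x, C x -> `|ev F f x| <= e].

(* compact sets being stable under finite unions, the balls of the seminorms
   sup_C |f| form a base of neighbourhoods, not just a subbase *)
Definition has_compact_open_topology X :=
  forall (f : F X) (A : set (F X)), nbhs f A <->
    exists C : set X, compact C /\
      exists2 e : K, 0 < e & [set g | seminorm_ball C e (g - f)] `<=` A.

Definition composition_well_defined X (psi : X -> X) :=
  forall f : F X, exists g : F X, ev F g = ev F f \o psi.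

Definition composition_operator X (psi : X -> X)
    (h : composition_well_defined psi) (f : F X) : F X :=
  sval (cid (h f)).

Definition dense_restriction X Y := dense (range (@res K Omega F X Y)).

Definition local_approximation X :=
  exists2 Xs : nat -> set Omega, exhaustion Xs X
    & forall n (x : Omega), (X `\` closure (Xs n)) x ->
      forall W, open W -> W `<=` X `\` closure (Xs n) -> W x ->
      exists U, [/\ open U, U `<=` W, U x & dense_restriction X (Xs n `|` U)].

End Sheaf.

Definition stable_orbits (T : topologicalType) (psi : T -> T) :=
  forall C : set T, compact C ->
    exists2 L : set T, compact L
      & forall m, (0 < m)%N -> iter m psi @` C `<=` L.

(* Main.v *)
(* Write C for the operator f |-> f o psi.  Stable orbits bound sup_K |C^m f| by
   sup_L |f|, so C is power bounded.  In a Montel space the Cesaro means of a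
   power bounded operator have cluster points, and Yosida's argument together
   with equicontinuity on compact sets gives uniform mean ergodicity.  If C is
   mean ergodic, then C^m f / m is bounded for every f, so barrelledness gives
   p(C^m f) <= m q(f), and C is topologizable.  Finally, if C is topologizable
   with sup_K |C^m f| <= gamma_m c sup_L |f|, take L inside X_n: should some
   y = psi^m(x), x in K, lie outside the closure of X_n, gluing 0 on X_n with a
   section not vanishing at y and approximating by elements of F(X) gives f small
   on L but not at y.  Hence all orbits of K stay in the closure of X_n.  The
   closed graph theorem is not needed, since C is visibly continuous for the
   compact-open topology. *)
Require Import Defs.
From mathcomp Require Import all_boot all_order all_algebra.
From mathcomp Require Import all_classical all_reals all_analysis.
From mathcomp Require Import complex ring.
Import Order.TTheory GRing.Theory Num.Theory.
Import numFieldNormedType.Exports.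
Local Open Scope classical_set_scope.
Local Open Scope ring_scope.
Set Implicit Arguments.
Unset Strict Implicit.
Unset Printing Implicit Defensive.

(** * Suprema and the Archimedean property in the scalars *)

Lemma scalars_lub (R : realType) (K : numFieldType) (A : set K) :
  real_or_complex R K -> (forall x, A x -> 0 <= x) -> (exists M, ubound A M) ->
  exists s, [/\ 0 <= s, ubound A s & forall t, 0 <= t -> ubound A t -> s <= t].
Proof.
move=> hK; case: hK A => A A0 [M AM].
  have [->|/set0P A_neq0] := eqVneq A set0.
    by exists 0; split => // x [].
  have hA : has_sup A by split => //; exists M.
  exists (sup A); split.
  - by case: A_neq0 => x Ax; apply: (le_trans (A0 _ Ax)); exact: sup_upper_bound.
  - exact: sup_upper_bound.
  - by move=> t _ At; apply: ge_sup.
have [->|/set0P A_neq0] := eqVneq A set0.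
  by exists 0; split => // x [].
(* Nonnegative elements of [R[i]] have zero imaginary part, so the supremum of the real parts
   serves. For empty [A] the value is 0, least among nonnegative bounds only. *)
pose B := [set complex.Re x | x in A].
have ReA x : A x -> x = (complex.Re x)%:C%C.
  by move=> /A0; case: x => a b; rewrite lecE => /= /andP[/eqP -> _].
have hB : has_sup B.
  split; first by case: A_neq0 => x Ax; exists (complex.Re x), x.
  by exists (complex.Re M) => _ [x Ax <-]; have := AM x Ax; rewrite lecE => /andP[].
exists (sup B)%:C%C; split.
- case: A_neq0 => x Ax; have := A0 _ Ax; rewrite (ReA x Ax) !lecE /= eqxx /=.
  by move=> x0; apply: (le_trans x0); apply: sup_upper_bound => //; exists x.
- move=> x Ax; rewrite (ReA x Ax) lecE /= eqxx /=.
  by apply: sup_upper_bound => //; exists x.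
- move=> t t0 At; move: (t0); rewrite !lecE /= => /andP[/eqP -> _]; rewrite eqxx /=.
  apply: ge_sup; first by case: A_neq0 => x Ax; exists (complex.Re x), x.
  by move=> _ [x Ax <-]; have := At x Ax; rewrite lecE => /andP[].
Qed.

Lemma scalars_archimedean (R : realType) (K : numFieldType) (x : K) :
  real_or_complex R K -> 0 <= x -> exists n : nat, x <= n%:R.
Proof.
move=> hK; case: hK x => x x0.
  by exists (Num.bound x); rewrite ltW// archi_boundP.
exists (Num.bound (complex.Re x)).
move: x0; rewrite lecE /= => /andP[/eqP Imx Rex].
have -> : (Num.bound (complex.Re x))%:R = ((Num.bound (complex.Re x))%:R)%:C%C :> R[i].
  by rewrite rmorph_nat.
by rewrite lecE /= Imx eqxx /= ltW// archi_boundP.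
Qed.

(** * Seminorms *)

Section Seminorms.
Variables (K : numFieldType) (E : tvsType K).
Implicit Types (p q : E -> K) (x y : E).

Lemma seminorm0 p : continuous_seminorm p -> p 0 = 0.
Proof. by case=> _ pZ _ _; rewrite -(scale0r 0) pZ normr0 mul0r. Qed.

Lemma seminormN p x : continuous_seminorm p -> p (- x) = p x.
Proof. by case=> _ pZ _ _; rewrite -scaleN1r pZ normrN1 mul1r. Qed.

Lemma seminormB p x y : continuous_seminorm p -> p (x - y) = p (y - x).
Proof. by move=> ps; rewrite -opprB seminormN. Qed.

Lemma seminorm_triangle p z x y :
  continuous_seminorm p -> p (x - y) <= p (x - z) + p (z - y).
Proof. by case=> _ _ pD _; rewrite -(subrKA z); exact: pD. Qed.

Lemma seminorm_sum p n (u : nat -> E) : continuous_seminorm p ->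
  p (\sum_(0 <= i < n) u i) <= \sum_(0 <= i < n) p (u i).
Proof.
move=> ps; case: (ps) => _ _ pD _.
apply: (big_ind2 (fun a b => p a <= b)) => //; first by rewrite seminorm0.
by move=> a a' b b' h h'; apply: (le_trans (pD _ _)); exact: lerD.
Qed.

Lemma sub_cst_continuous (x : E) : continuous (fun y => y - x).
Proof.
move=> y.
apply: (@continuous_comp _ _ _ (fun y : E => (y, x)) (fun z : E * E => z.1 - z.2)).
  by apply: cvg_pair => /=; [exact: cvg_id|exact: cvg_cst].
exact: sub_continuous.
Qed.

Lemma nbhs_seminorm p x (e : K) :
  continuous_seminorm p -> 0 < e -> nbhs x [set y | p (y - x) <= e].
Proof.
move=> ps e0; case: (ps) => p0 _ _ pc.
have : (p \o (fun y => y - x)) z @[z --> x] --> p (x - x).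
  apply: (@continuous_comp _ _ _ (fun y => y - x) p); first exact: sub_cst_continuous.
  exact: pc.
rewrite subrr seminorm0 // => /cvgr0_norm_le /(_ _ e0).
by apply: filterS => y /=; rewrite ger0_norm.
Qed.

Lemma nbhs0_seminorm p (e : K) :
  continuous_seminorm p -> 0 < e -> nbhs 0 [set y | p y <= e].
Proof.
move=> ps e0; have := nbhs_seminorm 0 ps e0.
by apply: filterS => y /=; rewrite subr0.
Qed.

Lemma nbhs_translate x (U : set E) : nbhs x U <-> nbhs 0 [set y | U (x + y)].
Proof.
have addc (a b : E) : (fun y => a + y) z @[z --> b] --> a + b.
  apply: (@continuous_comp _ _ _ (fun y : E => (a, y)) (fun z : E * E => z.1 + z.2)).
    by apply: cvg_pair => /=; [exact: cvg_cst|exact: cvg_id].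
  exact: add_continuous.
split=> [xU|U0]; first by apply: (addc x 0); rewrite addr0.
have h := addc (- x) x; rewrite addNr in h.
have h2 := h _ U0; rewrite /nbhs /= in h2 *; apply: filterS h2 => y /=.
by rewrite addNKr.
Qed.

(** The reverse triangle inequality [|p x - p (x + y)| <= p y] carries continuity from 0 to every
    point. *)
Lemma seminorm_of_ball p : (forall x, 0 <= p x) ->
  (forall (a : K) x, p (a *: x) = `|a| * p x) ->
  (forall x y, p (x + y) <= p x + p y) ->
  (forall e : K, 0 < e -> nbhs 0 [set x | p x <= e]) -> continuous_seminorm p.
Proof.
move=> p0 pZ pD pe; split => // x; apply/cvgrPdist_le => e e0.
apply/nbhs_translate; apply: filterS (pe _ e0) => y /= ye.
have pN z : p (- z) = p z by rewrite -scaleN1r pZ normrN1 mul1r.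
rewrite real_ler_distl; last by rewrite realB// ger0_real.
rewrite lerBlDr (le_trans (pD _ _)) ?lerD2l//=.
have {1}-> : x = (x + y) + (- y) by rewrite addrK.
by rewrite (le_trans (pD _ _)) // pN lerD2l.
Qed.

Lemma seminorm_scale p (c : K) :
  continuous_seminorm p -> 0 <= c -> continuous_seminorm (fun x => c * p x).
Proof.
move=> [p0 pZ pD pc] c0; split.
- by move=> x; rewrite mulr_ge0.
- by move=> a x; rewrite pZ mulrCA.
- by move=> x y; rewrite -mulrDr ler_wpM2l.
- by move=> x; apply: cvgM; [exact: cvg_cst|exact: pc].
Qed.

Lemma seminorm_comp p (T : E -> E) : (forall x y, T (x + y) = T x + T y) ->
  (forall (a : K) x, T (a *: x) = a *: T x) -> continuous T ->
  continuous_seminorm p -> continuous_seminorm (p \o T).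
Proof.
move=> TD TZ Tc [p0 pZ pD pc]; split => //= [a x|x y|x].
- by rewrite TZ pZ.
- by rewrite TD.
- by apply: continuous_comp; [exact: Tc|exact: pc].
Qed.

(** By homogeneity it suffices to rescale [x] so that [q x = e]; this fails only when [q x = 0],
    where every multiple of [x] satisfies the premise and [p x] must vanish. *)
Lemma seminorm_dominated p q (c e : K) :
  (forall x, 0 <= p x) -> (forall (a : K) x, p (a *: x) = `|a| * p x) ->
  (forall x, 0 <= q x) -> (forall (a : K) x, q (a *: x) = `|a| * q x) ->
  0 < e -> 0 <= c -> (forall x, q x <= e -> p x <= c) ->
  forall x, p x <= c / e * q x.
Proof.
move=> p0 pZ q0 qZ e0 c0 qp x.
have [qx0|qx_neq0] := eqVneq (q x) 0.
  rewrite qx0 mulr0; apply/ler_addgt0Pr => d d0; rewrite add0r.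
  have c1 : 0 < c + 1 by rewrite ltr_wpDl.
  (* The factor is built on [c + 1] rather than [c] to stay positive when [c = 0]. *)
  have ad0 : 0 < (c + 1) / d by rewrite divr_gt0.
  have := qp (((c + 1) / d) *: x); rewrite qZ qx0 mulr0 => /(_ (ltW e0)).
  rewrite pZ gtr0_norm // mulrAC ler_pdivrMr // => h.
  have : (c + 1) * p x <= (c + 1) * d.
    by apply: (le_trans h); rewrite ler_wpM2r ?ltW// ltr_pwDr.
  by rewrite ler_pM2l.
have qx : 0 < q x by rewrite lt_neqAle eq_sym qx_neq0 q0.
have := qp ((e / q x) *: x); rewrite qZ gtr0_norm ?divr_gt0// divfK //.
move=> /(_ (lexx _)); rewrite pZ gtr0_norm ?divr_gt0// => h.
by move: h; rewrite mulrAC ler_pdivrMr // [c / e * _]mulrAC ler_pdivlMr // mulrC.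
Qed.

(** Local convexity, phrased so that the compact-open topology can supply it through sup seminorms,
    without Minkowski gauges valued in [K]. *)
Definition seminorm_base := forall U : set E, nbhs 0 U ->
  exists2 p, continuous_seminorm p & forall x, p x <= 1 -> U x.

End Seminorms.

(** * Power bounded and mean ergodic operators *)

Section Ergodic.
Variables (K : numFieldType) (E : tvsType K) (T : E -> E).
Hypotheses (TD : forall x y, T (x + y) = T x + T y)
  (TZ : forall (a : K) x, T (a *: x) = a *: T x).
Hypothesis K_archi : forall x : K, 0 <= x -> exists n : nat, x <= n%:R.
Implicit Types (p q : E -> K) (x y : E).

Lemma iterD m x y : iter m T (x + y) = iter m T x + iter m T y.
Proof. by elim: m => //= m ->; rewrite TD. Qed.

Lemma iterZ m (a : K) x : iter m T (a *: x) = a *: iter m T x.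
Proof. by elim: m => //= m ->; rewrite TZ. Qed.

Lemma iterB m x y : iter m T (x - y) = iter m T x - iter m T y.
Proof. by rewrite -scaleN1r iterD iterZ scaleN1r. Qed.

(* Definitionally trivial, but restates the mean along the instance path of
   [K] and [E] on which the module lemmas can rewrite. *)
Lemma cesaroE n x :
  cesaro_mean T n x = (n%:R^-1 : K) *: \sum_(1 <= m < n.+1) iter m T x.
Proof. by []. Qed.

Lemma cesaroD n x y : cesaro_mean T n (x + y) = cesaro_mean T n x + cesaro_mean T n y.
Proof.
rewrite cesaroE; under eq_bigr do rewrite iterD.
by rewrite big_split scalerDr.
Qed.

Lemma cesaroZ n (a : K) x : cesaro_mean T n (a *: x) = a *: cesaro_mean T n x.
Proof.
rewrite cesaroE; under eq_bigr do rewrite iterZ.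
by rewrite -scaler_sumr !scalerA mulrC.
Qed.

Lemma cesaroB n x y : cesaro_mean T n (x - y) = cesaro_mean T n x - cesaro_mean T n y.
Proof. by rewrite -scaleN1r cesaroD cesaroZ scaleN1r. Qed.

Lemma scale_natV_mulrn n y : (0 < n)%N -> (n%:R^-1 : K) *: (y *+ n) = y.
Proof.
move=> n0; have -> : y *+ n = (n%:R : K) *: y by rewrite scaler_nat.
by rewrite scalerA mulVf ?scale1r // pnatr_eq0 -lt0n.
Qed.

Lemma cesaro_fixed n y : (0 < n)%N -> T y = y -> cesaro_mean T n y = y.
Proof.
move=> n0 Ty; rewrite cesaroE (eq_bigr (fun=> y)); last first.
  by move=> m _; elim: m => //= m ->.
by rewrite sumr_const_nat subSS subn0 scale_natV_mulrn.
Qed.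

Lemma cesaro_coboundary n x :
  cesaro_mean T n (x - T x) = n%:R^-1 *: (T x - iter n.+1 T x).
Proof.
rewrite cesaroE (eq_bigr (fun m => - (iter m.+1 T x - iter m T x))).
  by rewrite sumrN telescope_sumr // opprB.
by move=> m _; rewrite opprB iterB -iterSr.
Qed.

Lemma cesaro_comm n x : cesaro_mean T n (T x) = T (cesaro_mean T n x).
Proof.
rewrite cesaroE; under eq_bigr do rewrite -iterSr.
rewrite TZ (big_morph T TD (_ : T 0 = 0)) //.
by have := TZ 0 0; rewrite !scale0r.
Qed.

Lemma seminorm_cesaro p q n x : continuous_seminorm p ->
  (forall m, (0 < m)%N -> p (iter m T x) <= q x) -> 0 <= q x ->
  p (cesaro_mean T n x) <= q x.
Proof.
move=> ps pq q0; case: (ps) => _ pZ _ _.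
have [->|n0] := posnP n.
  by rewrite cesaroE big_geq // scaler0 seminorm0.
rewrite cesaroE pZ ger0_norm ?invr_ge0 ?ler0n //.
rewrite ler_pdivrMl ?ltr0n // big_add1 /= (le_trans (seminorm_sum _ _ ps)) //.
rewrite mulr_natl -[n in leRHS]subn0 -sumr_const_nat.
by apply: ler_sum => m _; exact: (pq m.+1).
Qed.

Lemma divr_nat_le (c e : K) : 0 <= c -> 0 < e ->
  exists2 N, (0 < N)%N & forall n, (N <= n)%N -> n%:R^-1 * c <= e.
Proof.
move=> c0 e0; have [N cN] := K_archi (divr_ge0 c0 (ltW e0)).
exists N.+1 => // n Nn.
rewrite ler_pdivrMl ?ltr0n ?(leq_trans _ Nn)// -ler_pdivrMr //.
by apply: (le_trans cN); rewrite ler_nat ltnW.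
Qed.

(** The vectors that the mean ergodic projection will send to 0; they form a subspace. *)
Definition cesaro_null x := forall p, continuous_seminorm p -> forall e : K, 0 < e ->
  exists N, forall n, (N <= n)%N -> p (cesaro_mean T n x) <= e.

Lemma cesaro_nullD x y : cesaro_null x -> cesaro_null y -> cesaro_null (x + y).
Proof.
move=> hx hy p ps e e0; have e2 : 0 < e / 2 by rewrite divr_gt0.
have [N hN] := hx p ps _ e2; have [M hM] := hy p ps _ e2.
exists (maxn N M) => n; rewrite geq_max => /andP[Nn Mn].
case: (ps) => _ _ pD _; rewrite cesaroD (le_trans (pD _ _)) // [e]splitr.
by rewrite lerD ?hN ?hM.
Qed.

Lemma cesaro_nullZ (a : K) x : cesaro_null x -> cesaro_null (a *: x).
Proof.
move=> hx p ps e e0; have a1 : 0 < `|a| + 1 by rewrite ltr_wpDl.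
have [N hN] := hx p ps (e / (`|a| + 1)) (divr_gt0 e0 a1).
exists N => n Nn; case: (ps) => p0 pZ _ _; rewrite cesaroZ pZ.
have := hN n Nn; rewrite ler_pdivlMr // mulrC; apply: le_trans.
by rewrite ler_wpM2r // lerDl.
Qed.

Lemma cesaro_null0 : cesaro_null 0.
Proof.
move=> p ps e e0; exists 0 => n _; have := cesaroZ n 0 0.
by rewrite !scale0r => ->; rewrite seminorm0 // ltW.
Qed.

(** * Yosida's argument for power bounded operators *)

Section PowerBounded.
Hypothesis T_pb : power_bounded T.

(** By telescoping, the n-th mean is [(T x - T^(n+1) x) / n], of seminorm at most [2 q(x) / n]. *)
Lemma cesaro_null_coboundary x : cesaro_null (x - T x).
Proof.
move=> p ps e e0; have [q qs pq] := T_pb ps; case: (qs) => q0 _ _ _.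
have [N N0 hN] := divr_nat_le (addr_ge0 (q0 x) (q0 x)) e0.
exists N => n Nn; rewrite cesaro_coboundary; case: (ps) => _ pZ pD _.
rewrite pZ ger0_norm ?invr_ge0 ?ler0n //; apply: le_trans (hN _ Nn).
rewrite ler_wpM2l ?invr_ge0 ?ler0n // (le_trans (pD _ _)) // seminormN //.
by rewrite lerD // ?(pq n.+1)// (pq 1).
Qed.

Lemma cesaro_null_iter m x : cesaro_null (x - iter m T x).
Proof.
elim: m => [|m IH]; first by rewrite subrr; exact: cesaro_null0.
rewrite -(subrKA (iter m T x)); apply: cesaro_nullD => //.
exact: cesaro_null_coboundary.
Qed.

(** The difference is the average of the vectors [x - T^m x], each of which is a sum of
    coboundaries. *)
Lemma cesaro_null_cesaro n x : (0 < n)%N -> cesaro_null (x - cesaro_mean T n x).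
Proof.
move=> n0.
have -> : x - cesaro_mean T n x =
    (n%:R^-1 : K) *: \sum_(1 <= m < n.+1) (x - iter m T x).
  by rewrite sumrB scalerBr sumr_const_nat subSS subn0 scale_natV_mulrn // cesaroE.
apply: cesaro_nullZ; apply: (big_ind cesaro_null).
- exact: cesaro_null0.
- exact: cesaro_nullD.
- by move=> m _; exact: cesaro_null_iter.
Qed.

Hypotheses (T_cont : continuous T) (E_base : seminorm_base E) (E_montel : montel E).

Lemma seminorm_separates x : (forall p, continuous_seminorm p -> p x = 0) -> x = 0.
Proof.
move=> px; case: E_montel => hE _ _; apply: hE => A B /nbhs_singleton Ax.
move=> /E_base[p ps pB]; exists x; split => //; apply: pB.
by rewrite px.
Qed.

Lemma cesaro_bounded x : bounded_subset (range (fun n => cesaro_mean T n x)).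
Proof.
move=> U /E_base[p ps pU]; have [q qs pq] := T_pb ps.
case: (ps) => _ pZ _ _; case: (qs) => q0 _ _ _.
have r0 : 0 < q x + 1 by rewrite ltr_wpDl.
exists (q x + 1) => // a qa _ [n _ <-].
have a_neq0 : a != 0 by rewrite -normr_gt0 (lt_le_trans r0).
exists (a^-1 *: cesaro_mean T n x); last by rewrite scalerA divff // scale1r.
apply: pU; rewrite pZ normfV ler_pdivrMl ?normr_gt0 // mulr1.
rewrite (le_trans (seminorm_cesaro n ps _ (q0 x))) //.
  by move=> m m0; exact: pq.
by apply: le_trans qa; rewrite lerDl.
Qed.

(** The Montel property gives the means [u n] a cluster point [y], which [T] fixes. With [u M] close
    to [y], split [x - y] into [x - u M], whose means tend to 0, and [u M - y], whose means are
    bounded by [q (u M - y)]. *)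
Lemma cesaro_limit x : exists y, forall p, continuous_seminorm p ->
  forall e : K, 0 < e -> exists N,
    forall n, (N <= n)%N -> p (cesaro_mean T n x - y) <= e.
Proof.
case: E_montel => _ _ /(_ _ (cesaro_bounded x)) cc.
set u := fun n => cesaro_mean T n x.
have [y [_ yc]] : closure (range u) `&` cluster (u @ \oo) !=set0.
  by apply: cc; exists 0%N => // n _; apply: subset_closure; exists n.
have uy p (e : K) N : continuous_seminorm p -> 0 < e ->
    exists2 n, (N <= n)%N & p (u n - y) <= e.
  move=> ps e0.
  have [|_ [/= [n Nn <-] pn]] :=
    yc [set u n | n in [set n | (N <= n)%N]] _ _ (nbhs_seminorm y ps e0).
    by exists N => // n /= Nn; exists n.
  by exists n.
(* [T u_n - u_n] tends to 0, and [y] is a cluster point of [u]. *)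
have Ty : T y = y.
  apply/eqP; rewrite -subr_eq0; apply/eqP; apply: seminorm_separates => p ps.
  apply/le_anti/andP; split; last by case: ps.
  apply/ler_addgt0Pr => e e0; rewrite add0r.
  have [N NP] : exists N, forall n, (N <= n)%N -> p (u n - T (u n)) <= e / 2.
    have e2 : 0 < e / 2 by rewrite divr_gt0.
    have [N hN] := cesaro_null_coboundary x ps e2.
    by exists N => n /hN; rewrite cesaroB cesaro_comm.
  (* One seminorm controls both [u n - y] and its image under [T], so a single index makes both
     small. *)
  pose q z := p z + p (T z).
  have qs : continuous_seminorm q.
    have [q0 qZ qD qc] := seminorm_comp TD TZ T_cont ps.
    case: (ps) => p0 pZ pD pc; split => [z|a z|z w|z]; rewrite /q.
    - by rewrite addr_ge0.
    - by rewrite pZ [p (T _)]qZ mulrDr.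
    - by rewrite (le_trans (lerD (pD _ _) (qD _ _))) // addrACA.
    - by apply: cvgD; [exact: pc|exact: qc].
  have [n Nn qn] := uy q _ N qs (divr_gt0 e0 (ltr0n _ 2)).
  apply: (le_trans (seminorm_triangle (T (u n)) _ _ ps)).
  rewrite (le_trans (lerD (lexx _) (seminorm_triangle (u n) _ _ ps))) //.
  rewrite (seminormB (T y)) // -[T (u n) - T y](iterB 1) (seminormB (T (u n))) //.
  rewrite addrCA [leRHS]splitr lerD ?NP //.
  by rewrite addrC.
exists y => p ps e e0; have [q qs pq] := T_pb ps.
have e2 : 0 < e / 2 by rewrite divr_gt0.
(* Asking for an index at least 1 excludes the default mean 0 at index 0. *)
have [M M0 qM] := uy q _ 1 qs e2.
have [N hN] := cesaro_null_cesaro x M0 ps e2.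
exists (maxn N 1) => n; rewrite geq_max => /andP[Nn n0].
rewrite -[y in X in X <= _](cesaro_fixed n0 Ty) -cesaroB -(subrKA (u M)) cesaroD.
case: (ps) (qs) => _ _ pD _ [q0 _ _ _].
rewrite (le_trans (pD _ _)) // [e]splitr lerD ?hN //.
apply: le_trans qM; apply: seminorm_cesaro => // m m0; exact: pq.
Qed.

(** Power boundedness makes the means equicontinuous, so pointwise convergence is uniform near each
    point, hence on the closure of [B], which is compact by the Montel property. *)
Lemma power_bounded_uniformly_mean_ergodic : uniformly_mean_ergodic T.
Proof.
have [P hP] := choice cesaro_limit.
exists P => B Bb U /E_base[p ps pU].
case: E_montel => _ _ /(_ _ Bb)/compact_near_coveringP cB.
suff : \forall n \near \oo, closure B `<=` (fun x => U (cesaro_mean T n x - P x)).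
  by apply: filterS => n h x Bx; apply: h; exact: subset_closure.
apply: cB => x _; have [q qs pq] := T_pb ps; case: (qs) => q0 _ _ _.
have e0 : 0 < 5^-1 :> K by rewrite invr_gt0 ltr0n.
have pqn n z : p (cesaro_mean T n z) <= q z.
  by apply: seminorm_cesaro => // m m0; exact: pq.
have [N hN] := hP x p ps _ e0.
exists ([set z | q (z - x) <= 5^-1], [set n | (N <= n)%N]).
  by split; [exact: nbhs_seminorm|exists N].
move=> [z n] /= [qz Nn]; apply: pU.
(* [M] depends on [z] but only helps to bound [p (P x - P z)], which takes three of the five terms
   below; the threshold [N] for [n] depends on [x] alone. *)
have [M hM] := hP z p ps _ e0.
have PzPx : p (P x - P z) <= 5^-1 + (5^-1 + 5^-1).
  pose k := maxn N M.
  rewrite (le_trans (seminorm_triangle (cesaro_mean T k x) _ _ ps)) // lerD //.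
    by rewrite seminormB // hN // leq_maxl.
  rewrite (le_trans (seminorm_triangle (cesaro_mean T k z) _ _ ps)) // lerD //.
    by rewrite -cesaroB (le_trans (pqn _ _)) // seminormB.
  by rewrite hM // leq_maxr.
apply: (le_trans (seminorm_triangle (cesaro_mean T n x) _ _ ps)).
have -> : 1 = 5^-1 + (5^-1 + (5^-1 + (5^-1 + 5^-1))) :> K by field.
rewrite lerD //; first by rewrite -cesaroB (le_trans (pqn _ _)).
by rewrite (le_trans (seminorm_triangle (P x) _ _ ps)) // lerD // hN.
Qed.

End PowerBounded.

(** * Consequences of mean ergodicity, and comparison of the boundedness notions *)

Lemma uniformly_mean_ergodic_mean_ergodic : uniformly_mean_ergodic T -> mean_ergodic T.
Proof.
move=> [P hP] x; exists (P x) => U /nbhs_translate U0.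
(* Singletons are bounded because scalar multiplication is continuous at [(0, x)]. *)
have xb : bounded_subset [set x].
  move=> V V0.
  have := @scale_continuous K E (0, x) V; rewrite scale0r => /(_ V0).
  move=> [[A B] /= [A0 /nbhs_singleton Bx] AB].
  have /nbhs_ballP[d /= d0 dA] := A0.
  have dV (a : K) : ball 0 d a -> V (a *: x) by move=> /dA Aa; exact: (AB (a, x)).
  (* Doubling yields the strict inequality [d^-1 < |a|] demanded by the open ball. *)
  exists (d^-1 + d^-1); first by rewrite addr_gt0 ?invr_gt0.
  move=> a ad _ ->.
  have d1 : d^-1 < `|a| by apply: lt_le_trans ad; rewrite ltrDl invr_gt0.
  have a0 : 0 < `|a| by apply: lt_trans d1; rewrite invr_gt0.
  exists (a^-1 *: x); last by rewrite scalerA divff ?scale1r // -normr_gt0.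
  apply: dV; rewrite /ball /= sub0r normrN normfV.
  by rewrite -[d]invrK ltf_pV2 // posrE invr_gt0.
have := hP _ xb _ U0; apply: filterS => n /(_ x erefl) /=.
by rewrite addrC subrK.
Qed.

(** Since [T^m x] is a difference of multiples of two consecutive means, [p (T^m x) / m] is bounded
    for each [x]. Hence [A] below absorbs points and is a barrel; a seminorm ball inside it gives
    [gamma_m = m]. *)
Lemma mean_ergodic_topologizable :
  continuous T -> seminorm_base E -> barrelled E -> mean_ergodic T -> topologizable T.
Proof.
move=> Tc Eb barE me p ps; case: (ps) => p0 pZ pD pc.
have itercont m : continuous (iter m T).
  elim: m => [|m IH] x; first exact: cvg_id.
  by apply: (@continuous_comp _ _ _ (iter m T) T); [exact: IH|exact: Tc].
have pm m := seminorm_comp (iterD m) (iterZ m) (itercont m) ps.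
pose A := [set x | forall m, (0 < m)%N -> p (iter m T x) <= m%:R].
have Abar : barrel A.
  split.
  - move=> x Ax m m0; apply/ler_addgt0Pr => e e0.
    have [y [Ay]] := Ax _ (nbhs_seminorm x (pm m) e0).
    rewrite /= => yx; case: (pm m) => _ _ /(_ y (x - y)) + _ /=.
    rewrite addrC subrK => /le_trans; apply.
    by rewrite lerD ?Ay // [leLHS](seminormB x y (pm m)).
  - move=> a b x y ab Ax Ay m m0; rewrite iterD !iterZ (le_trans (pD _ _)) //.
    rewrite !pZ (@le_trans _ _ ((`|a| + `|b|) * m%:R)) //.
      by rewrite mulrDl lerD // ler_wpM2l // ?Ax ?Ay.
    by rewrite -[leRHS]mul1r ler_wpM2r ?ler0n.
  - move=> x; have [l ul] := me x.
    have : p (cesaro_mean T n x) @[n --> \oo] --> p l.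
      exact: (cvg_comp _ _ ul (pc l)).
    move=> /cvgr_dist_le /(_ _ ltr01) [N _ hN].
    (* The limit plus 1 bounds the tail of the means, the finite sum the first [N] of them. *)
    pose M := p l + 1 + \sum_(0 <= i < N) p (cesaro_mean T i x).
    have s0 : 0 <= \sum_(0 <= i < N) p (cesaro_mean T i x) by exact: sumr_ge0.
    have pM n : p (cesaro_mean T n x) <= M.
      have [Nn|nN] := leqP N n.
        have := hN n Nn; rewrite /= real_ler_distl ?realB ?ger0_real //.
        move=> /andP[_]; rewrite /= => h.
        have := hN n Nn; rewrite /= distrC real_ler_distl ?realB ?ger0_real //.
        by move=> /andP[_] /le_trans; apply; rewrite lerDl.
      rewrite /M (bigD1_seq n) ?mem_index_iota ?iota_uniq //= addrCA lerDl.
      by rewrite addr_ge0 ?addr_ge0 ?sumr_ge0.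
    have M0 : 0 < M by rewrite ltr_wpDr // ltr_wpDl.
    have pT m : (0 < m)%N -> p (iter m T x) <= m%:R * (M + M).
      case: m => // m _.
      (* The bound obtained is [(m + 1) M + m M], at most [(m + 1) (M + M)]. For [m = 0] the factor
         0 cancels the default mean. *)
      have -> : iter m.+1 T x =
          m.+1%:R *: cesaro_mean T m.+1 x - m%:R *: cesaro_mean T m x.
        have S n : n%:R *: cesaro_mean T n x = \sum_(1 <= i < n.+1) iter i T x.
          have [->|n0] := posnP n; first by rewrite big_geq // scale0r.
          by rewrite scalerA divff ?scale1r // pnatr_eq0 -lt0n.
        by rewrite !S [in RHS]big_nat_recr //= addrAC subrr add0r.
      move: (pM m.+1) (pM m).
      move: (cesaro_mean T m.+1 x) (cesaro_mean T m x) => z w zM wM.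
      rewrite (le_trans (pD _ _)) // seminormN // !pZ !normr_nat mulrDr.
      by rewrite lerD // ler_pM ?ler0n ?ler_nat.
    exists (M + M); first by rewrite addr_gt0.
    move=> a Ma _ ->.
    have a0 : 0 < `|a| by apply: lt_le_trans Ma; rewrite addr_gt0.
    exists (a^-1 *: x); last by rewrite scalerA divff ?scale1r // -normr_gt0.
    move=> m m0; rewrite iterZ pZ normfV ler_pdivrMl // mulrC.
    by rewrite (le_trans (pT m m0)) // ler_wpM2l ?ler0n.
have [q qs qA] := Eb _ (barE _ Abar); exists q => // m m0.
case: (qs) (pm m) => q0 qZ _ _ [pm0 pmZ _ _].
exists m%:R; first by rewrite ltr0n.
move=> x; have := seminorm_dominated pm0 pmZ q0 qZ ltr01 (ler0n _ m) _ x.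
by rewrite divr1; apply => z /qA; exact.
Qed.

Lemma power_bounded_m_topologizable : power_bounded T -> m_topologizable T.
Proof.
move=> pb p /pb[q qs pq]; exists q => //; exists 1 => // m x m0.
by rewrite expr1n mul1r pq.
Qed.

Lemma m_topologizable_topologizable : m_topologizable T -> topologizable T.
Proof.
move=> mt p /mt[q qs [g g0 pq]]; exists q => // m m0.
by exists (g ^+ m) => [|x]; [rewrite exprn_gt0|exact: pq].
Qed.

End Ergodic.

(** * Spaces of functions with the compact-open topology *)

Definition sub_point (T : Type) (A : set T) (x : T) (Ax : A x) : A :=
  exist (fun x => x \in A) x (mem_set Ax).

(** A cluster point of the pushed-forward filter lies in [Z], hence lifts to [Y], and open sets of
    the subtype are traces of open sets of [T]. *)
Lemma compact_subtype (T : topologicalType) (Y Z : set T) :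
  compact Z -> Z `<=` Y -> compact (set_val @^-1` Z : set Y).
Proof.
move=> cZ ZY G GP GZ.
have [z [Zz clz]] : Z `&` cluster (set_val @ G) !=set0 by exact: cZ.
exists (sub_point (ZY _ Zz)); split => // A B GA [_ [[W oW <-] /= Wz WB]].
have [_ [[a Aa <-] Wa]] : set_val @` A `&` W !=set0.
  apply: clz; last exact: open_nbhs_nbhs.
  by rewrite /nbhs/=; apply: filterS GA => a Aa; exists a.
by exists a; split => //; exact: WB.
Qed.

Section CompactOpen.
Variables (R : realType) (K : numFieldType) (hK : real_or_complex R K).
Variables (Omega : topologicalType) (F : function_space_family K Omega).
Variables (X : set Omega).
Hypothesis ev_linear : forall (a : K) (f g : F X) (x : X),
  ev F (a *: f + g) x = a * ev F f x + ev F g x.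
Hypothesis X_co : has_compact_open_topology F X.
Implicit Types (f g : F X) (C L : set X).

Lemma evD f g x : ev F (f + g) x = ev F f x + ev F g x.
Proof. by have := ev_linear 1 f g x; rewrite scale1r mul1r. Qed.

Lemma ev0 x : ev F (0 : F X) x = 0.
Proof. by apply: (addrI (ev F (0 : F X) x)); rewrite -evD !addr0. Qed.

Lemma evZ (a : K) f x : ev F (a *: f) x = a * ev F f x.
Proof. by have := ev_linear a f 0 x; rewrite ev0 !addr0. Qed.

Lemma evB f g x : ev F (f - g) x = ev F f x - ev F g x.
Proof. by rewrite -scaleN1r evD evZ mulN1r. Qed.

Lemma nbhs0_seminorm_ball C (e : K) :
  compact C -> 0 < e -> nbhs 0 (seminorm_ball (F:=F) C e).
Proof.
move=> cC e0; apply/X_co; exists C; split => //; exists e => // f /=.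
by rewrite subr0.
Qed.

(** Scalar multiplication is continuous at [(0, f)], so a small positive multiple of [f] lies in the
    unit ball of sup over [C]. *)
Lemma ev_bounded C f : compact C -> exists M : K, forall x, C x -> `|ev F f x| <= M.
Proof.
move=> cC.
have := @scale_continuous K (F X) (0, f) (seminorm_ball C 1).
rewrite scale0r => /(_ (nbhs0_seminorm_ball cC ltr01)).
move=> [[A B] /= [A0 /nbhs_singleton Bf] AB].
have /nbhs_ballP[d /= d0 dA] := A0.
have d20 : 0 < d / 2 by rewrite divr_gt0.
have /AB h : (A `*` B) (d / 2, f).
  split=> //=; apply: dA; rewrite /ball /= sub0r normrN gtr0_norm //.
  by rewrite ltr_pdivrMr // ltr_pMr // ltr1n.
exists (d / 2)^-1 => x /h /=; rewrite evZ normrM gtr0_norm //.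
by rewrite -ler_pdivlMl // mulr1.
Qed.

(** This is sup over [C] of [|f|], specified as a least nonnegative bound so that an empty [C] and
    moduli in [R[i]] are covered too. *)
Lemma sup_seminorm_ex C : compact C -> exists p : F X -> K,
  [/\ continuous_seminorm p, forall f x, C x -> `|ev F f x| <= p f
    & forall f t, 0 <= t -> (forall x, C x -> `|ev F f x| <= t) -> p f <= t].
Proof.
move=> cC.
have /choice[p hp] f : exists s : K,
    [/\ 0 <= s, forall x, C x -> `|ev F f x| <= s
      & forall t, 0 <= t -> (forall x, C x -> `|ev F f x| <= t) -> s <= t].
  have [||s [s0 As sA]] := @scalars_lub R K [set `|ev F f x| | x in C] hK.
  - by move=> _ [x _ <-].
  - by have [M fM] := ev_bounded f cC; exists M => _ [x Cx <-]; exact: fM.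
  exists s; split => // [x Cx|t t0 ft]; first by apply: As; exists x.
  by apply: sA => // _ [x Cx <-]; exact: ft.
have p0 f : 0 <= p f by case: (hp f).
have pub f x : C x -> `|ev F f x| <= p f by case: (hp f) => _ + _; exact.
have plub f t : 0 <= t -> (forall x, C x -> `|ev F f x| <= t) -> p f <= t.
  by case: (hp f) => _ _; exact.
exists p; split => //.
have pZle (a : K) f : p (a *: f) <= `|a| * p f.
  by apply: plub => [|x Cx]; rewrite ?mulr_ge0 // evZ normrM ler_wpM2l // pub.
apply: seminorm_of_ball => // [a f|f g|e e0].
(* The reverse inequality is [pZle] applied to [a^-1] and [a *: f]. *)
- apply/le_anti; rewrite pZle /=.
  have [->|a0] := eqVneq a 0; first by rewrite normr0 mul0r.
  rewrite -ler_pdivlMl ?normr_gt0 // -normfV (le_trans _ (pZle _ _)) //.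
  by rewrite scalerA mulVf // scale1r.
- apply: plub => [|x Cx]; first by rewrite addr_ge0.
  by rewrite evD (le_trans (ler_normD _ _)) // lerD ?pub.
- apply: filterS (nbhs0_seminorm_ball cC e0) => f fe /=.
  by apply: plub => //; exact: ltW.
Qed.

Lemma compact_open_seminorm_base : seminorm_base (F X).
Proof.
move=> U /X_co[C [cC [e e0 CU]]].
have [p [ps pC _]] := sup_seminorm_ex cC.
have ei : 0 < e^-1 by rewrite invr_gt0.
exists (fun f => e^-1 * p f); first by apply: seminorm_scale => //; exact: ltW.
move=> f; rewrite ler_pdivrMl // mulr1 => pf; apply: CU => x Cx.
by rewrite subr0 (le_trans (pC _ _ Cx)).
Qed.

(** The unit ball of [p] contains a ball of some sup seminorm; homogeneity turns this inclusion into
    an inequality. *)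
Lemma seminorm_le_sup (p : F X -> K) : continuous_seminorm p ->
  exists2 C, compact C & exists2 c : K, 0 < c &
    forall f t, 0 <= t -> (forall x, C x -> `|ev F f x| <= t) -> p f <= c * t.
Proof.
move=> ps; have /X_co[C [cC [e e0 Ce]]] := nbhs0_seminorm ps ltr01.
have [q [qs qC Cq]] := sup_seminorm_ex cC.
exists C => //; exists e^-1; first by rewrite invr_gt0.
move=> f t t0 ft; case: (ps) (qs) => p0 pZ _ _ [q0 qZ _ _].
have := seminorm_dominated p0 pZ q0 qZ e0 ler01 _ f; rewrite div1r => h.
apply: (le_trans (h _)); last first.
  by apply: ler_wpM2l; [rewrite invr_ge0 ltW|exact: Cq].
move=> g qg; apply: Ce => x Cx; rewrite subr0; exact: le_trans (qC _ _ Cx) qg.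
Qed.

(** * The composition operator *)

Variables (psi : X -> X) (psi_continuous : continuous psi).
Variables (C_wd : composition_well_defined F psi).
Hypothesis ev_inj : injective (@ev K Omega F X).
Let T := composition_operator C_wd.

Lemma ev_composition f x : ev F (T f) x = ev F f (psi x).
Proof. by rewrite /T /composition_operator; case: cid => g /= ->. Qed.

Lemma ev_iter_composition m f x : ev F (iter m T f) x = ev F f (iter m psi x).
Proof. by elim: m x => //= m IH x; rewrite ev_composition IH -iterS iterSr. Qed.

Lemma compositionD f g : T (f + g) = T f + T g.
Proof.
by apply: ev_inj; apply/funext => x; rewrite evD !ev_composition evD.
Qed.

Lemma compositionZ (a : K) f : T (a *: f) = a *: T f.
Proof.
by apply: ev_inj; apply/funext => x; rewrite evZ !ev_composition evZ.
Qed.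

(** The sup of [|f o psi|] over [C] is the sup of [|f|] over the compact set [psi(C)]. *)
Lemma composition_continuous : continuous T.
Proof.
move=> f U /X_co[C [cC [e e0 CU]]]; apply/X_co; exists (psi @` C); split.
  by apply: continuous_compact => //; exact: continuous_subspaceT.
exists e => // g gf; apply: CU => x Cx.
have := gf (psi x) (ex_intro2 _ _ x Cx erefl).
by rewrite !evB !ev_composition.
Qed.

Lemma stable_orbits_power_bounded : stable_orbits psi -> power_bounded T.
Proof.
move=> so p ps; have [C cC [c c0 pC]] := seminorm_le_sup ps.
have [L cL CL] := so C cC; have [q [qs qL _]] := sup_seminorm_ex cL.
exists (fun f => c * q f); first by apply: seminorm_scale => //; exact: ltW.
move=> m f m0; case: (qs) => q0 _ _ _; apply: pC => // x Cx.
by rewrite ev_iter_composition qL //; apply: (CL m) => //; exists x.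
Qed.

End CompactOpen.

(** * Gluing, approximation and stable orbits *)

Section Approximation.
Variables (R : realType) (K : numFieldType) (hK : real_or_complex R K).
Variables (Omega : topologicalType) (F : function_space_family K Omega).
Hypothesis F_sheaf : sheaf_of_functions F.
Hypothesis F_co : forall Y : set Omega, open Y -> has_compact_open_topology F Y.

(** Disjointness makes compatibility on overlaps vacuous, so the sheaf axiom glues 0 on [V] with [g]
    on [U]. *)
Lemma glue_zero (V U : set Omega) (g : F U) : open V -> open U -> V `&` U = set0 ->
  exists h : F (V `|` U), forall z : (V `|` U : set Omega),
    (V (set_val z) -> ev F h z = 0) /\
    (forall y : U, set_val y = set_val z -> ev F h z = ev F g y).
Proof.
move=> oV oU VU.
pose W (b : bool) := if b then V else U.
have oW b : open (W b) by case: b.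
have Wcov : open_cover W (V `|` U).
  split => //; apply/seteqP; split => [x [[] _ Wx]|x [Vx|Ux]]; [by left|by right| |].
    by exists true.
  by exists false.
pose f b : F (W b) := if b is true then 0 : F V else g.
have disj (x : V) (y : U) : set_val x <> set_val y.
  move=> xy; suff : (V `&` U) (set_val x) by rewrite VU.
  by split; [exact: set_valP|rewrite xy; exact: set_valP].
have fagree b c : agree (ev F (f b)) (ev F (f c)).
  case: b; case: c => x y xy.
  - by rewrite (val_inj xy).
  - by case: (disj x y).
  - by case: (disj y x).
  - by rewrite (val_inj xy).
have [h hf] := sections_glue F_sheaf (openU oV oU) Wcov fagree.
exists h => z; split => [Vz|y yz].
  have := sections_restrict F_sheaf (openU oV oU) oV (@subsetUl _ V U) h.
  move=> /(_ z (sub_point Vz) erefl) ->.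
  have -> : res F V h = 0 by exact: (hf true).
  exact: (ev0 (sections_linear F_sheaf oV)).
have := sections_restrict F_sheaf (openU oV oU) oU (@subsetUr _ V U) h.
by move=> /(_ z y (esym yz)) ->; rewrite (hf false).
Qed.

Variables (X : set Omega) (X_open : open X).

(** Glue 0 on [V] with the restriction of [g] to [U], then use density to approximate the result,
    uniformly on the compact set formed by [L] and [y], by a section over all of [X]. *)
Lemma peak_function (V U : set Omega) (L : set X) (y : X) (g : F X) (e : K) :
  open V -> open U -> V `&` U = set0 -> V `|` U `<=` X ->
  dense_restriction F X (V `|` U) ->
  compact L -> set_val @` L `<=` V -> U (set_val y) -> 0 < e ->
  exists f : F X, (forall x, L x -> `|ev F f x| <= e) /\ `|ev F f y - ev F g y| <= e.
Proof.
move=> oV oU VU VUX dr cL LV Uy e0.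
have oY := openU oV oU.
have UX : U `<=` X by move=> x Ux; apply: VUX; right.
have [h hh] := glue_zero (res F U g) oV oU VU.
pose y' : (V `|` U : set Omega) := sub_point (or_intror Uy).
have cL' : compact (set_val @` L).
  apply: continuous_compact => //; apply: continuous_subspaceT.
  exact: initial_continuous.
pose C : set (V `|` U : set Omega) := set_val @^-1` (set_val @` L) `|` [set y'].
have cC : compact C.
  apply: compactU; last exact: compact_set1.
  by apply: compact_subtype => // x /LV Vx; left.
have hN : nbhs h [set k | seminorm_ball C e (k - h)].
  by apply/(F_co oY); exists C; split => //; exists e.
(* Density is tested on open sets, hence the passage to the interior of the ball around [h]. *)
have [k [/interior_subset kh [f _ fk]]] := dr _ (ex_intro _ h hN) (open_interior _).
have resE := sections_restrict F_sheaf X_open oY VUX f.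
have resgE := sections_restrict F_sheaf X_open oU UX g.
have evE := evB (sections_linear F_sheaf oY).
exists f; split.
  move=> x Lx; have Vx : V (set_val x) by apply: LV; exists x.
  pose x' : (V `|` U : set Omega) := sub_point (or_introl Vx).
  have := kh x' (or_introl (ex_intro2 _ _ x Lx erefl)).
  by rewrite evE (proj1 (hh x')) // subr0 -fk -(resE x x').
have := kh y' (or_intror erefl).
rewrite evE (proj2 (hh y') (sub_point Uy)) // -fk -(resE y y') //.
by rewrite -(resgE y).
Qed.

Lemma exhaustion_compact (Xs : nat -> set Omega) (L : set X) :
  exhaustion Xs X -> compact L -> exists n, set_val @` L `<=` Xs n.
Proof.
move=> [oXs _ Xs1 XsX] /compact_near_coveringP cL.
have mono m n : (m <= n)%N -> Xs m `<=` Xs n.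
  elim: n => [|n IH]; first by rewrite leqn0 => /eqP ->.
  rewrite leq_eqVlt => /predU1P[-> //|]; rewrite ltnS => /IH mn x /mn xn.
  by apply: Xs1; exact: subset_closure.
have [|N _ hN] := cL nat \oo (fun n x => Xs n (set_val x)) _.
  move=> x _; have : X (set_val x) by exact: set_valP.
  rewrite -{1}XsX => -[m _ xm].
  exists (set_val @^-1` Xs m, [set n | (m <= n)%N]); last first.
    by move=> [z n] /= [zm mn]; exact: mono zm.
  split; last by exists m.
  by apply: initial_continuous; exact: open_nbhs_nbhs.
by exists N => _ [x Lx <-]; exact: (hN N (leqnn N) x Lx).
Qed.

Variables (psi : X -> X) (C_wd : composition_well_defined F psi).

(** The order of choices matters: [n] comes from [q] alone, so the compact set is the same for all
    [m], while [gamma_m] only enters the accuracy [e], fixed after [m]. *)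
Lemma topologizable_stable_orbits :
  local_approximation F X ->
  (forall x : X, [set f : F X | eval_at x f = 0] <> [set: F X]) ->
  topologizable (composition_operator C_wd) -> stable_orbits psi.
Proof.
move=> [Xs Xexh approx] cond_b top C cC.
have lin := sections_linear F_sheaf X_open.
have [p [ps pC _]] := sup_seminorm_ex hK lin (F_co X_open) cC.
have [q qs pq] := top p ps.
have [L cL [c c0 qL]] := seminorm_le_sup hK lin (F_co X_open) qs.
have [n Ln] := exhaustion_compact Xexh cL.
case: (Xexh) => oXs cXs Xs1 XsX.
have clX : closure (Xs n) `<=` X by move=> x /Xs1 xn; rewrite -XsX; exists n.+1.
exists (set_val @^-1` closure (Xs n)).
  exact: compact_subtype.
move=> m m0 _ [x Cx <-]; apply: contrapT => nyX.
set y := iter m psi x in nyX.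
have [g gy] : exists g : F X, ev F g y != 0.
  apply: contrapT => ng; apply: (cond_b y); apply/seteqP; split => // f _ /=.
  by apply: contrapT => /eqP fy; apply: ng; exists f.
have oD : open (X `\` closure (Xs n)).
  rewrite setDE; apply: openI => //; apply: closed_openC; exact: closed_closure.
have Dy : (X `\` closure (Xs n)) (set_val y) by split => //; exact: set_valP.
have [U [oU UD Uy dr]] := approx n (set_val y) Dy _ oD (@subset_refl _ _) Dy.
have [gam gam0 pqm] := pq m m0.
have d0 : 0 < 1 + gam * c by rewrite (addr_gt0 ltr01) ?mulr_gt0.
(* The triangle inequality will give [|g(y)| <= (1 + gam * c) * e]; the extra 1 in the denominator
   makes the right side strictly smaller than [|g(y)|], a contradiction. *)
pose e := `|ev F g y| / (1 + (1 + gam * c)).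
have e0 : 0 < e by rewrite divr_gt0 ?normr_gt0 ?(addr_gt0 ltr01 d0).
have XsU : Xs n `&` U = set0.
  apply/seteqP; split => // z [zn /UD[_]]; apply; exact: subset_closure.
have XsUX : Xs n `|` U `<=` X.
  by move=> z [zn|/UD[]//]; apply: clX; exact: subset_closure.
have [f [fL fy]] := peak_function g (oXs n) oU XsU XsUX dr cL Ln Uy e0.
have fye : `|ev F f y| <= gam * (c * e).
  rewrite /y -(ev_iter_composition C_wd); apply: (le_trans (pC _ _ Cx)).
  by apply: (le_trans (pqm f)); rewrite ler_pM2l // qL // ltW.
have : `|ev F g y| <= e + gam * (c * e).
  by rewrite -[ev F g y](subrK (ev F f y)) (le_trans (ler_normD _ _)) // lerD // distrC.
have s0 := addr_ge0 (ltW e0) (mulr_ge0 (ltW gam0) (mulr_ge0 (ltW c0) (ltW e0))).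
apply/negP; rewrite -real_ltNge ?ger0_real //.
have -> : e + gam * (c * e) = (1 + gam * c) * e by ring.
rewrite {1}/e mulrCA gtr_pMr ?normr_gt0 // ltr_pdivrMr ?(addr_gt0 ltr01 d0) // mul1r.
by rewrite ltrDr.
Qed.

End Approximation.

(** * The cycle of implications *)

Theorem corollary3p8 (R : realType) (K : numFieldType)
  (hK : real_or_complex R K)
  (Omega : topologicalType)
  (Omega_hausdorff : hausdorff_space Omega)
  (Omega_locally_compact : locally_compact [set: Omega])
  (Omega_sigma_compact : sigma_compact Omega)
  (Omega_noncompact : ~ compact [set: Omega])
  (F : function_space_family K Omega)
  (F_sheaf : sheaf_of_functions F)
  (F_F1 : property_F1 F)
  (F_compact_open : forall Y : set Omega, open Y -> has_compact_open_topology F Y)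
  (F_frechet : forall Y : set Omega, open Y -> frechet (F Y) R)
  (F_montel : forall Y : set Omega, open Y -> montel (F Y))
  (X : set Omega) (X_open : open X)
  (psi : X -> X) (psi_continuous : continuous psi)
  (C_wd : composition_well_defined F psi)
  (cond_a : local_approximation F X)
  (cond_b : forall x : X, [set f : F X | eval_at x f = 0] <> [set: F X]) :
  [<-> power_bounded (composition_operator C_wd);
       uniformly_mean_ergodic (composition_operator C_wd);
       mean_ergodic (composition_operator C_wd);
       m_topologizable (composition_operator C_wd);
       topologizable (composition_operator C_wd);
       stable_orbits psi].
Proof.
have lin := sections_linear F_sheaf X_open.
have inj := sections_inj F_sheaf X_open.
have co := F_compact_open X X_open.
have base := compact_open_seminorm_base hK lin co.
have arch (x : K) : 0 <= x -> exists n : nat, x <= n%:R := scalars_archimedean hK.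
have TD := compositionD lin C_wd inj.
have TZ := compositionZ lin C_wd inj.
have Tc : continuous (composition_operator C_wd).
  exact: composition_continuous.
have top_stable : topologizable (composition_operator C_wd) -> stable_orbits psi.
  exact: (topologizable_stable_orbits hK F_sheaf F_compact_open X_open cond_a cond_b).
have stable_pb : stable_orbits psi -> power_bounded (composition_operator C_wd).
  exact: (stable_orbits_power_bounded hK lin co).
have pb_ume (pb : power_bounded (composition_operator C_wd)) :=
  power_bounded_uniformly_mean_ergodic TD TZ arch pb Tc base (F_montel X X_open).
have me_top := mean_ergodic_topologizable TD TZ Tc base.
have barX : barrelled (F X) by case: (F_montel X X_open).
tfae.
- exact: pb_ume.
- exact: uniformly_mean_ergodic_mean_ergodic.
(* The passage from (iii) to (iv) runs through (v), (vi) and (i). *)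
- by move=> /(me_top barX)/top_stable/stable_pb; exact: power_bounded_m_topologizable.
- exact: m_topologizable_topologizable.
- exact: top_stable.
- exact: stable_pb.
Qed.
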